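(* Consider a real normed space $(Y,\|\cdot\|)$ with dimension two or higher and nontrivial cones $K,A\subseteq Y$ (with the norm-bases $B_K(\|\cdot\|)$ and $B_A(\|\cdot\|)$, respectively). Suppose that $$A\cap\operatorname{cl}(\operatorname{conv}(-K))=\{0\}\quad\text{and}\quad 0\notin\operatorname{cl}S_{-K}(\|\cdot\|).$$ Moreover, assume that one of the following statements is valid: (a) $B_A(\|\cdot\|)$ is compact. (b) $A$ is weakly closed, and either $Y$ is reflexive or $\operatorname{cl}_wB_A(\|\cdot\|)$ is weakly compact with $0\notin\operatorname{cl}_wB_A(\|\cdot\|)$. Then there is a norm $\|\cdot\|'$ on $Y$ equivalent to $\|\cdot\|$ such that $(\operatorname{cl}S^0_A(\|\cdot\|'))\cap(\operatorname{cl}S_{-K}(\|\cdot\|'))=\emptyset$.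
   Context: A set $K\subseteq Y$ is a cone if $0\in K=[0,\infty)\cdot K$ (not necessarily convex); it is nontrivial if $\{0\}\ne K\ne Y$. For a cone $C$ and a norm $\psi$: $B_C(\psi):=\{x\in C\mid\psi(x)=1\}$ (the norm-base of $C$), $S_C(\psi):=\operatorname{conv}(B_C(\psi))$, $S^0_C(\psi):=\operatorname{conv}(\{0\}\cup B_C(\psi))$. $\operatorname{cl}$ is the norm closure, $\operatorname{cl}_w$ the weak closure. *)

(* Defs.v *)
From HB Require Import structures.
From mathcomp Require Import all_boot all_order all_algebra.
From mathcomp Require Import all_classical all_reals all_analysis.

Set Implicit Arguments.
Unset Strict Implicit.
Unset Printing Implicit Defensive.

Import Order.TTheory GRing.Theory Num.Theory.
Import numFieldNormedType.Exports.

Local Open Scope classical_set_scope.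
Local Open Scope ring_scope.

Section ContinuousDual.
Context {R : realType} (Y : normedModType R).

Definition dual_pred : {pred Y -> R^o} :=
  mem [set f : Y -> R^o | linear f /\ continuous f].

Fact dual_submod_closed : submod_closed dual_pred.
Proof.
split.
  rewrite inE; split; last exact: cst_continuous.
  by move=> a x y; rewrite scaler0 addr0.
move=> a f g; rewrite !inE => -[lf cf] [lg cg]; split.
  move=> b x y; rewrite /= !fctE lf lg !scalerDr !scalerA (mulrC b a).
  by rewrite addrACA.
move=> x; apply: (@continuousD _ _ _ (a *: f) g); last exact: cg.
by apply: (@continuousZl_tmp _ _ _ f); exact: cf.
Qed.

HB.instance Definition _ :=
  GRing.isSubmodClosed.Build R (Y -> R^o) dual_pred dual_submod_closed.

Record dual := Dual { dual_fun :> Y -> R^o; _ : dual_fun \in dual_pred }.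

HB.instance Definition _ := [isSub for dual_fun].
HB.instance Definition _ := [Choice of dual by <:].
HB.instance Definition _ := [SubChoice_isSubLmodule of dual by <:].

Implicit Types (f g : dual) (x y : Y).

Lemma dual_linear f : linear f.
Proof. by have := valP f; rewrite inE => -[]. Qed.

Lemma dual_continuous f : continuous f.
Proof. by have := valP f; rewrite inE => -[]. Qed.

Lemma dualZ f (a : R) x : f (a *: x) = a * f x.
Proof.
have f0 : f 0 = 0.
  by have := dual_linear f (-1) 0 0; rewrite scaleN1r oppr0 addr0 scaleN1r addNr.
by have := dual_linear f a x 0; rewrite f0 !addr0.
Qed.

Definition opnorm f : R := sup [set `|f x| | x in [set x | `|x| <= 1]].

Lemma opnorm_has_sup f : has_sup [set `|f x| | x in [set x | `|x| <= 1]].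
Proof.
split; first by exists `|f 0|, 0 => //=; rewrite normr0.
pose L := GRing.isLinear.Build R Y R^o *:%R f (dual_linear f).
pose fL : {linear Y -> R^o} := HB.pack (f : Y -> R^o) L.
have /linear_boundedP/pinfty_ex_gt0[r r0 fr] : bounded_near fL (nbhs 0).
  by apply/linear_bounded_continuous; exact: dual_continuous.
exists r => _ [x /= x1 <-]; apply: (le_trans (fr x)).
by rewrite ler_piMr// ltW.
Qed.

Lemma opnorm_ge0 f : 0 <= opnorm f.
Proof.
apply: (le_trans (normr_ge0 (f 0))); apply: sup_upper_bound.
  exact: opnorm_has_sup.
by exists 0 => //=; rewrite normr0.
Qed.

Lemma opnormP f x : `|f x| <= opnorm f * `|x|.
Proof.
have [->|x0] := eqVneq x 0.
  by rewrite -(scale0r (0 : Y)) dualZ mul0r normr0 mulr_ge0// opnorm_ge0.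
rewrite -ler_pdivrMr ?normr_gt0// mulrC -[X in X * _]ger0_norm ?invr_ge0//.
rewrite -normrM -dualZ; apply: sup_upper_bound; first exact: opnorm_has_sup.
by exists (`|x|^-1 *: x) => //=; rewrite normrZ normfV normr_id mulVf ?normr_eq0.
Qed.

Lemma opnorm_le f (c : R) :
  (forall x, `|x| <= 1 -> `|f x| <= c) -> opnorm f <= c.
Proof.
move=> fc; apply: ge_sup; first by have [] := opnorm_has_sup f.
by move=> _ [x /= x1 <-]; exact: fc.
Qed.

Lemma opnormD f g : opnorm (f + g) <= opnorm f + opnorm g.
Proof.
apply: opnorm_le => x x1; apply: (le_trans (ler_normD (f x) (g x))).
apply: lerD; apply: (le_trans (opnormP _ _)); rewrite ler_piMr//;
exact: opnorm_ge0.
Qed.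

Lemma opnormZ (a : R) f : opnorm (a *: f) = `|a| * opnorm f.
Proof.
have le_opnormZ (b : R) g : opnorm (b *: g) <= `|b| * opnorm g.
  apply: opnorm_le => x x1; rewrite [X in `|X|](_ : _ = b * g x)// normrM.
  rewrite ler_wpM2l// (le_trans (opnormP _ _))// ler_piMr// opnorm_ge0//.
apply/eqP; rewrite eq_le le_opnormZ/=.
have [->|a0] := eqVneq a 0; first by rewrite normr0 mul0r opnorm_ge0.
rewrite -ler_pdivlMl ?normr_gt0// -normfV.
by rewrite -{1}(scalerK a0 f) le_opnormZ.
Qed.

Lemma opnorm_eq0 f : opnorm f = 0 -> f = 0.
Proof.
move=> f0; apply: val_inj; apply/funext => x; apply/eqP.
by rewrite -normr_le0 (le_trans (opnormP f x))// f0 mul0r.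
Qed.

HB.instance Definition _ :=
  Lmodule_isNormed.Build R dual opnormD opnormZ opnorm_eq0.

End ContinuousDual.

Arguments dual_fun {R Y} d x.
Arguments opnorm {R Y} f.

Section WeakTopology.
Context {R : realType} (Y : normedModType R).

(* The canonical embedding of Y into its bidual is onto. *)
Definition reflexive_space :=
  forall Phi : dual (dual Y), exists y : Y, forall f : dual Y, Phi f = f y.

(* Y with the coarsest topology making every element of [dual Y] continuous.  *)
Definition weak_space : topologicalType :=
  sup_topology (fun f : dual Y => Topological.on (initial_topology (dual_fun f))).

Definition weakly_closed (E : set Y) := closed (E : set weak_space).

Definition weakly_compact (E : set Y) := compact (E : set weak_space).

Definition weak_closure (E : set Y) : set Y := closure (E : set weak_space).

End WeakTopology.

Section Cones.
Context {R : realType} {Y : normedModType R}.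
Implicit Types (C K E : set Y) (psi : Y -> R).

Definition is_cone K :=
  K 0 /\ K = [set t *: x | t in [set t : R | 0 <= t] & x in K].

Definition nontrivial K := K <> [set 0] /\ K <> setT.

Definition opp_set K : set Y := -%R @` K.

Definition conv_hull E : set Y := smallest (@convex_set R Y) E.

Definition norm_base C psi : set Y := [set x | C x /\ psi x = 1].

Definition conv_base C psi : set Y := conv_hull (norm_base C psi).

Definition conv_base0 C psi : set Y := conv_hull ([set 0] `|` norm_base C psi).

(* Nonnegativity follows from the last two conditions. *)
Definition is_norm psi :=
  [/\ forall x, psi x = 0 -> x = 0,
      forall (a : R) x, psi (a *: x) = `|a| * psi x
    & forall x y, psi (x + y) <= psi x + psi y].

Definition equivalent_norms psi1 psi2 :=
  exists c1 c2 : R, [/\ 0 < c1, 0 < c2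
    & forall x, c1 * psi1 x <= psi2 x /\ psi2 x <= c2 * psi1 x].

End Cones.

(* Stated with two independent vectors, as Y may be infinite-dimensional. *)
Definition dim_ge2 {R : realType} (Y : normedModType R) :=
  exists u v : Y, forall a b : R, a *: u + b *: v = 0 -> a = 0 /\ b = 0.

(* Main.v *)
From HB Require Import structures.
Require Import Defs.
From mathcomp Require Import all_boot all_order all_algebra.
From mathcomp Require Import all_classical all_reals all_analysis.
From mathcomp Require Import ring lra.
Import Order.TTheory GRing.Theory Num.Theory.
Import numFieldNormedType.Exports.
Local Open Scope classical_set_scope.
Local Open Scope ring_scope.

(* Let C = conv(-K). Separating 0 from cl S_{-K} gives a continuous linear f
   with f(c) >= d |c| on C for some d > 0. Moreover |a - c| >= e |a| for some
   e > 0 and all a in A, c in C: otherwise there are a_n in B_A and c_n in C with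
   a_n - c_n -> 0; along an ultrafilter the a_n converge weakly to some p in A,
   so do the c_n, hence p lies in A and in cl C, that is p = 0, contradicting
   f(c_n) >= d |c_n| -> d. Finally one builds an equivalent norm psi with
   psi <= f on C and f <= (1 - eps) psi on A, so that the half-spaces {f >= 1}
   and {f <= 1 - eps} contain the two closed convex hulls. *)

(** * Sublinear functions and the Hahn-Banach theorem *)

Section Sublinear.
Context {R : realType} {V : lmodType R}.
Implicit Types (p q : V -> R) (S : V -> R -> Prop).

Definition sublinear p :=
  (forall x y, p (x + y) <= p x + p y) /\
  (forall (t : R) x, 0 < t -> p (t *: x) <= t * p x).

Lemma sublinear0 p : sublinear p -> p 0 = 0.
Proof.
move=> [pD pZ]; apply/eqP; rewrite eq_le.
have := pD 0 0; have := pZ 2^-1 0; rewrite addr0 scaler0 invr_gt0 => /(_ _).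
by move=> /(_ (ltr0n _ _)) ? ?; apply/andP; split; lra.
Qed.

Definition cone_inf S x : R := inf [set s | S x s].

(* The hypotheses say that [S], e.g. the epigraph of a sublinear function, is
   a convex cone with nonempty vertical fibers that meets the vertical axis
   only in its upper half. *)
Definition epi_cone S :=
  [/\ forall x y s t, S x s -> S y t -> S (x + y) (s + t),
      forall (a : R) x s, 0 < a -> S x s -> S (a *: x) (a * s),
      forall x, exists s, S x s
    & forall s, S 0 s -> 0 <= s].

(** The fiber over [x] is bounded below: if [t] lies in the fiber over [- x], then adding gives a
    point over 0, so every [u] over [x] satisfies [u >= - t]. *)
Lemma cone_inf_le S x s : epi_cone S -> S x s -> cone_inf S x <= s.
Proof.
move=> [SD SZ Sn S0] Sxs; apply: ge_inf => //=.
have [t St] := Sn (- x); exists (- t) => u /= Su.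
by have := SD _ _ _ _ Su St; rewrite subrr => /S0; lra.
Qed.

Lemma cone_inf_ge S x (c : R) : epi_cone S -> (forall s, S x s -> c <= s) ->
  c <= cone_inf S x.
Proof. by move=> [_ _ Sn _] cS; apply: lb_le_inf => //=; exact: Sn. Qed.

Lemma cone_inf_sublinear S : epi_cone S -> sublinear (cone_inf S).
Proof.
move=> eS; have [SD SZ Sn S0] := eS; split=> [x y|t x t0].
- rewrite -lerBlDr; apply: cone_inf_ge => // s Ss.
  rewrite lerBlDr -lerBlDl; apply: cone_inf_ge => // u Su.
  by rewrite lerBlDl; apply: cone_inf_le => //; exact: SD.
- rewrite -ler_pdivrMl//; apply: cone_inf_ge => // s Ss.
  by rewrite ler_pdivrMl//; apply: cone_inf_le => //; exact: SZ.
Qed.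

(** Supplies bounds of chains for Zorn's lemma. Sums stay in the cone because the smaller of two
    comparable members works at both points. *)
Lemma epi_cone_chain p (F : set (V -> R)) : F !=set0 ->
  F `<=` [set q | sublinear q /\ forall x, q x <= p x] ->
  (forall q r, F q -> F r -> (forall x, q x <= r x) \/ (forall x, r x <= q x)) ->
  epi_cone (fun x s => exists2 q, F q & q x <= s).
Proof.
move=> [q0 Fq0] Fp Ft; split=> [x y s t [q Fq qs] [r Fr rt]|a x s a0 [q Fq qs]|x|].
- have [qr|rq] := Ft _ _ Fq Fr.
    exists q => //; have [[qD _] _] := Fp _ Fq.
    by rewrite (le_trans (qD _ _))// lerD// (le_trans (qr _)).
  exists r => //; have [[rD _] _] := Fp _ Fr.
  by rewrite (le_trans (rD _ _))// lerD// (le_trans (rq _)).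
- exists q => //; have [[_ qZ] _] := Fp _ Fq.
  by rewrite (le_trans (qZ _ _ a0))// ler_pM2l.
- by exists (q0 x), q0.
- by move=> s [q /Fp[sq _]]; rewrite sublinear0.
Qed.

(** The fiber over 0 lies in the upper half because [t * q y <= q (t *: y)], which is the
    homogeneity inequality for [t^-1]. *)
Lemma epi_cone_dir q y : sublinear q ->
  epi_cone (fun x s => exists2 t, 0 <= t & q (x + t *: y) - t * q y <= s).
Proof.
move=> sq; have [qD qZ] := sq; split.
- move=> x1 x2 s1 s2 [t1 t10 h1] [t2 t20 h2].
  exists (t1 + t2); first exact: addr_ge0.
  have := qD (x1 + t1 *: y) (x2 + t2 *: y).
  rewrite addrACA -scalerDl; lra.
- move=> a x s a0 [t t0 h]; exists (a * t); first by rewrite mulr_ge0// ltW.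
  have := qZ a (x + t *: y) a0; rewrite scalerDr scalerA.
  have : a * (q (x + t *: y) - t * q y) <= a * s by rewrite ler_pM2l.
  lra.
- by move=> x; exists (q x), 0; rewrite ?scale0r ?addr0 ?mul0r ?subr0.
- move=> s [t]; rewrite le_eqVlt add0r => /predU1P[<-|t0].
    by rewrite scale0r mul0r sublinear0// subr0.
  apply: le_trans; rewrite subr_ge0.
  have := qZ t^-1 (t *: y); rewrite invr_gt0 => /(_ t0).
  by rewrite scalerK ?gt_eqF// ler_pdivlMl.
Qed.

(* By Zorn there is a minimal sublinear [q <= p]; it is additive because, for each
   [y], [inf_(t >= 0) q (x + t y) - t q y] is sublinear and at most [q x], hence
   equal to it. *)
Lemma hahn_banach p : sublinear p ->
  exists2 f : V -> R^o, linear f & forall x, f x <= p x.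
Proof.
move=> sp.
pose P q := sublinear q /\ forall x, q x <= p x.
pose T := {q : V -> R | P q}.
(* The order is reversed, so that a maximal element for Zorn is a minimal sublinear function. *)
pose Rel (q r : T) := `[< forall x, sval r x <= sval q x >].
have [|||F Ft|[q [sq qp]] qmin] := @Zorn T Rel.
- by move=> q; apply/asboolP.
- move=> q r s /asboolP qr /asboolP rs; apply/asboolP => x.
  exact: le_trans (qr x).
- move=> [q qP] [r rP] /asboolP/= qr /asboolP/= rq; apply: eq_exist.
  by apply/funext => x; apply/eqP; rewrite eq_le qr rq.
- have [[q0 Fq0]|/nonemptyPn F0] := pselect (F !=set0); last first.
    by exists (exist P p (conj sp (fun=> lexx _))) => q; rewrite F0.
  pose G := [set sval q | q in F].
  have eG : epi_cone (fun x s => exists2 q, G q & q x <= s).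
    apply: (@epi_cone_chain p); first by exists (sval q0), q0.
      by move=> _ [q _ <-]; exact: (svalP q).
    move=> _ _ [q Fq <-] [r Fr <-].
    by have [/asboolP|/asboolP] := Ft _ _ Fq Fr; [right|left].
  have lG (q : T) x : F q ->
      cone_inf (fun x s => exists2 r, G r & r x <= s) x <= sval q x.
    by move=> Fq; apply: cone_inf_le => //; exists (sval q) => //; exists q.
  have Pinf : sublinear (cone_inf (fun x s => exists2 q, G q & q x <= s)) /\
    forall x, cone_inf (fun x s => exists2 q, G q & q x <= s) x <= p x.
    split=> [|x]; first exact: cone_inf_sublinear.
    by apply: le_trans (lG _ _ Fq0) _; have [_] := svalP q0; exact.
  by exists (exist P _ Pinf) => q Fq; apply/asboolP => x /=; exact: lG.
have [qD qZ] := sq.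
have qB x y : q x + q y <= q (x + y).
  have eS := @epi_cone_dir q y sq; set S := (fun _ => _) in eS.
  have lS z : cone_inf S z <= q z.
    by apply: cone_inf_le => //; exists 0; rewrite ?scale0r ?addr0 ?mul0r ?subr0.
  have PS : sublinear (cone_inf S) /\ forall x, cone_inf S x <= p x.
    split=> [|z]; first exact: cone_inf_sublinear.
    exact: le_trans (lS z) _.
  have /(congr1 sval)/= qE : exist P _ PS = exist P q (conj sq qp).
    by apply: qmin; apply/asboolP.
  rewrite -lerBrDr -[q x]/((fun z => q z) x) -{1}qE.
  by apply: cone_inf_le => //; exists 1; rewrite ?scale1r ?mul1r.
have qDE x y : q (x + y) = q x + q y by apply/eqP; rewrite eq_le qD qB.
have q0 := sublinear0 _ sq.
have qN x : q (- x) = - q x.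
  by have := qDE x (- x); rewrite subrr q0; lra.
have qpZ t x : 0 < t -> q (t *: x) = t * q x.
  move=> t0; apply/eqP; rewrite eq_le qZ//= -ler_pdivlMl//.
  by rewrite (le_trans _ (qZ _ _ _)) ?invr_gt0// scalerK ?gt_eqF.
exists q => // a x y; rewrite qDE; congr (_ + _).
have [a0|a0|->] := ltgtP a 0; last by rewrite !scale0r q0.
- by rewrite -[a]opprK scaleNr qN qpZ ?oppr_gt0// scaleNr.
- exact: qpZ.
Qed.

End Sublinear.

(** * Convex hulls of cones and separation of a convex set from 0 *)

Section Convexity.
Context {R : realType} {Y : normedModType R}.
Implicit Types (E K : set Y) (f : dual Y).

Lemma convex_setP E : @convex_set R Y E <->
  (forall x y (t : R), E x -> E y -> 0 <= t -> t <= 1 ->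
    E (t *: x + (1 - t) *: y)).
Proof.
split=> [cE x y t Ex Ey t0 t1|cE x y t].
  have := cE x y (Itv01 t0 t1) (mem_set Ex) (mem_set Ey).
  by rewrite inE.
by rewrite !inE => Ex Ey; apply: cE.
Qed.

Lemma convex_conv_hull E : @convex_set R Y (conv_hull E).
Proof.
apply/convex_setP => x y t Hx Hy t0 t1 D [cD ED].
by move/convex_setP: (cD); apply; [exact: Hx|exact: Hy| |].
Qed.

Lemma sub_conv_hull E : E `<=` conv_hull E.
Proof. exact: sub_smallest. Qed.

Lemma conv_hull_min E D : @convex_set R Y D -> E `<=` D -> conv_hull E `<=` D.
Proof. by move=> cD ED; exact: smallest_sub. Qed.

Lemma coneZ K (t : R) x : is_cone K -> 0 <= t -> K x -> K (t *: x).
Proof.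
move=> [_ ->] t0 [s s0 [y Ky <-]]; rewrite scalerA.
by exists (t * s); [exact: mulr_ge0|exists y].
Qed.

Lemma opp_cone K : is_cone K -> is_cone (opp_set K).
Proof.
move=> cK; split; first by exists 0; [case: cK|rewrite oppr0].
rewrite eqEsubset; split=> [x [y Ky <-]|_ [t t0 [_ [y Ky <-] <-]]].
  by exists 1 => //=; exists (- y); [exists y|rewrite scale1r].
by exists (t *: y); [exact: coneZ|rewrite scalerN].
Qed.

(** The points that scaling by [a] sends into the hull form a convex set containing [K]. *)
Lemma conv_hull_coneZ K (a : R) x : is_cone K -> 0 <= a ->
  conv_hull K x -> conv_hull K (a *: x).
Proof.
move=> cK a0; move: x; apply: (@conv_hull_min _ [set x | conv_hull K (a *: x)]).
  apply/convex_setP => x y t /= Hx Hy t0 t1.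
  rewrite scalerDr !scalerA (mulrC a) (mulrC a) -!scalerA.
  by have /convex_setP := convex_conv_hull K; apply.
by move=> x Kx; apply: sub_conv_hull; exact: coneZ.
Qed.

Lemma conv_hull_coneD K x y : is_cone K ->
  conv_hull K x -> conv_hull K y -> conv_hull K (x + y).
Proof.
move=> cK Hx Hy; have -> : x + y = 2 *: (2^-1 *: x + (1 - 2^-1) *: y).
  rewrite scalerDr !scalerA mulfV ?scale1r ?pnatr_eq0//.
  by rewrite mulrBr mulr1 mulfV ?pnatr_eq0// -[2]/(1 + 1) addrK scale1r.
apply: conv_hull_coneZ => //.
by have /convex_setP := convex_conv_hull K; apply => //; lra.
Qed.

Lemma notin_closure E p : ~ closure E p ->
  exists2 r : R, 0 < r & forall x, E x -> r <= `|p - x|.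
Proof.
move=> nEp; apply: contrapT => h; apply: nEp => B /nbhs_ballP[r /= r0 rB].
apply: contrapT => nEB; apply: h; exists r => // x Ex.
rewrite leNgt; apply/negP => px; apply: nEB; exists x; split => //.
by apply: rB; rewrite -ball_normE.
Qed.

Lemma dualD f x y : f (x + y) = f x + f y.
Proof. by have := dual_linear f 1 x y; rewrite !scale1r. Qed.

Lemma dualN f x : f (- x) = - f x.
Proof. by rewrite -scaleN1r dualZ mulN1r. Qed.

Lemma dual0 f : f 0 = 0.
Proof. by rewrite -(scale0r 0) dualZ mul0r. Qed.

Lemma dual_of_bounded (g : Y -> R^o) (M : R) : linear g ->
  (forall x, `|g x| <= M * `|x|) -> exists f, dual_fun f = g.
Proof.
move=> lg gM; suff cg : continuous g.
  by have gP : g \in dual_pred (Y := Y); [rewrite inE; split|exists (Dual gP)].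
pose L := GRing.isLinear.Build R Y R^o *:%R g lg.
pose gL : {linear Y -> R^o} := HB.pack (g : Y -> R^o) L.
have : bounded_near gL (nbhs 0); last by move/linear_bounded_continuous.
apply/linear_boundedP; exists M; split; first exact: num_real.
by move=> N MN x; rewrite (le_trans (gM x))// ler_wpM2r// ltW.
Qed.

(* The gauge [p x], the infimum of [|x + t e| - t r] over [t >= 0] and [e] in
   [E], is finite because [|t e| - t r >= 0], and [p (- e) <= - r]. *)
Lemma convex_separation E (r : R) : @convex_set R Y E ->
  (forall x, E x -> r <= `|x|) -> exists f, forall x, E x -> r <= f x.
Proof.
move=> /convex_setP cE Er.
have [[e0 Ee0]|nE] := pselect (E !=set0); last first.
  by exists 0 => x Ex; exfalso; apply: nE; exists x.
pose S x (s : R) := exists t e, [/\ 0 <= t, E e & `|x + t *: e| - t * r <= s].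
have eS : epi_cone S.
  split.
  - move=> x y s1 s2 [t1 [e1 [t10 Ee1 h1]]] [t2 [e2 [t20 Ee2 h2]]].
    have [t120|t12] := eqVneq (t1 + t2) 0.
      have [t1E t2E] : t1 = 0 /\ t2 = 0 by split; lra.
      exists 0, e1; split => //; move: h1 h2; rewrite t1E t2E !scale0r !addr0.
      by have := ler_normD x y; lra.
    have t12p : 0 < t1 + t2 by rewrite lt_neqAle eq_sym t12 addr_ge0.
    (* The weights are chosen so that [t1 + t2] times this point of [E] is [t1 *: e1 + t2 *: e2]. *)
    exists (t1 + t2), ((t1 / (t1 + t2)) *: e1 + (1 - t1 / (t1 + t2)) *: e2).
    split; first exact: ltW.
    + apply: cE => //; first by rewrite divr_ge0// ltW.
      by rewrite ler_pdivrMr// mul1r lerDl.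
    + rewrite scalerDr !scalerA mulrBr mulr1 (mulrC _ (t1 / _)) divfK//.
      rewrite (addrC t1 t2) addrK addrACA mulrDl.
      have := ler_normD (x + t1 *: e1) (y + t2 *: e2); lra.
  - move=> a x s a0 [t [e [t0 Ee h]]]; exists (a * t), e; split => //.
      by rewrite mulr_ge0// ltW.
    rewrite -scalerA -scalerDr normrZ gtr0_norm// -mulrA -mulrBr.
    by rewrite ler_pM2l.
  - by move=> x; exists (`|x + 0 *: e0| - 0 * r), 0, e0.
  - move=> s [t [e [t0 Ee]]]; apply: le_trans.
    rewrite add0r normrZ ger0_norm// -mulrBr mulr_ge0// subr_ge0.
    exact: Er.
have [g lg gp] := @hahn_banach _ _ _ (@cone_inf_sublinear _ _ _ eS).
have gx x : g x <= `|x|.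
  apply: le_trans (gp x) _; apply: cone_inf_le => //.
  by exists 0, e0; split => //; rewrite scale0r addr0 mul0r subr0.
have gN x : g (- x) = - g x.
  have g0 : g 0 = 0 by have := lg (-1) 0 0; rewrite scaler0 addr0 scaleN1r addNr.
  by have := lg (-1) x 0; rewrite !scaleN1r g0 !addr0.
have [f fE] : exists f, dual_fun f = g.
  apply: (@dual_of_bounded _ 1) => // x; rewrite mul1r ler_norml gx andbT.
  by rewrite lerNl -gN (le_trans (gx _))// normrN.
exists f => x Ex; rewrite fE -lerN2 -gN; apply: le_trans (gp _) _.
apply: cone_inf_le => //; exists 1, x; split => //.
by rewrite scale1r addNr normr0 mul1r sub0r.
Qed.

End Convexity.

(** * Construction of the equivalent norm, and the gap between the cones *)

Section Renorming.
Context {R : realType} {Y : normedModType R}.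
Implicit Types (A C K : set Y) (f g : dual Y).

(* [psi x] is the infimum of [f c1 + f c2 + N |x - c1 + c2|] over [c1], [c2] in
   [C], where [N] exceeds the norm of [f] by 1. As [f x = f y + f c1 - f c2] with
   [y = x - c1 + c2], this expression minus [f x] is at least
   [2 f c2 + |y| >= k (|c2| + |y|) >= k |x - c1|]. *)
Lemma renorming C f (d : R) : is_cone C ->
  (forall x y, C x -> C y -> C (x + y)) -> 0 < d ->
  (forall c, C c -> d * `|c| <= f c) ->
  exists psi : Y -> R, [/\ is_norm psi, equivalent_norms (@Num.norm R Y) psi,
    forall c, C c -> psi c <= f c
  & exists2 k : R, 0 < k & forall x e, (forall c, C c -> e <= `|x - c|) ->
      f x + k * e <= psi x].
Proof.
move=> coneC CD d0 fC.
have C0 : C 0 by case: coneC.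
pose N := opnorm f + 1.
have N1 : 1 <= N by rewrite lerDr opnorm_ge0.
have N0 : 0 < N by exact: lt_le_trans N1.
have fN y : f y + `|y| <= N * `|y|.
  rewrite mulrDl mul1r lerD2r (le_trans (ler_norm _))//; exact: opnormP.
(* One constant for two estimates: [k <= d] bounds [k * |c|] by [f c] on [C], and [k <= 1] bounds
   [k * |y|] by [|y|]. *)
pose k := Num.min d 1.
have k0 : 0 < k by rewrite lt_min d0 ltr01.
have [kd k1] : k <= d /\ k <= 1 by rewrite !ge_min !lexx orbT.
have fk c : C c -> k * `|c| <= f c.
  by move=> Cc; apply: le_trans (fC _ Cc); rewrite ler_wpM2r.
have kn (y : Y) : k * `|y| <= `|y| by rewrite ler_piMl.
pose S x (s : R) := exists c1 c2,
  [/\ C c1, C c2 & f c1 + f c2 + N * `|x - c1 + c2| <= s].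
have Sk x s : S x s -> k * `|x| <= s.
  move=> [c1 [c2 [Cc1 Cc2]]]; apply: le_trans.
  have := fk _ Cc1; have := fk _ Cc2; have := kn (x - c1 + c2).
  have : `|x - c1 + c2| <= N * `|x - c1 + c2| by rewrite ler_peMl.
  have : k * `|x| <= k * (`|x - c1 + c2| + `|c1| + `|c2|).
    rewrite ler_pM2l// -{1}(subrK c1 x) -{1}(addrK c2 (x - c1)) addrAC.
    by rewrite (le_trans (ler_normB _ _))// lerD2r ler_normD.
  lra.
have eS : epi_cone S.
  split.
  - move=> x y s t [c1 [c2 [Cc1 Cc2 h1]]] [e1 [e2 [Ce1 Ce2 h2]]].
    exists (c1 + e1), (c2 + e2); split; [exact: CD|exact: CD|].
    rewrite !dualD opprD (addrACA x) (addrACA (x - c1)).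
    have := ler_normD (x - c1 + c2) (y - e1 + e2); rewrite -(ler_pM2l N0); lra.
  - move=> a x s a0 [c1 [c2 [Cc1 Cc2 h]]]; exists (a *: c1), (a *: c2).
    split; [apply: coneZ => //; exact: ltW..|].
    rewrite !dualZ -[a *: x - _]scalerBr -[a *: (x - c1) + _]scalerDr.
    by rewrite normrZ gtr0_norm// mulrCA -!mulrDr ler_pM2l.
  - by move=> x; exists (f 0 + f 0 + N * `|x - 0 + 0|), 0, 0.
  - by move=> s /Sk; rewrite normr0 mulr0.
have sub := @cone_inf_sublinear _ _ _ eS; set psi := cone_inf S in sub.
have psik x : k * `|x| <= psi x by apply: cone_inf_ge => // s; exact: Sk.
have psiN x : psi x <= N * `|x|.
  by apply: cone_inf_le => //; exists 0, 0; rewrite dual0 subr0 !addr0 add0r.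
(* Exchanging [c1] and [c2] turns a candidate for [x] into one for [- x] with the same value. *)
have psi_even x : psi (- x) = psi x.
  suff le y : psi (- y) <= psi y by apply/eqP; rewrite eq_le le -{1}(opprK x) le.
  apply: cone_inf_ge => // s [c1 [c2 [Cc1 Cc2 h]]].
  apply: cone_inf_le => //; exists c2, c1; split => //.
  have -> : - y - c2 + c1 = - (y - c1 + c2) by rewrite !opprD opprK addrAC.
  by rewrite normrN (addrC (f c2)).
have psipZ a x : 0 < a -> psi (a *: x) = a * psi x.
  move=> a0; have [_ pZ] := sub; apply/eqP; rewrite eq_le pZ//= -ler_pdivlMl//.
  by rewrite (le_trans _ (pZ _ _ _)) ?invr_gt0// scalerK ?gt_eqF.
exists psi; split.
- split.
  + move=> x p0; have := psik x; rewrite p0 pmulr_rle0// normr_le0.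
    by move/eqP.
  + move=> a x; have [a0|a0|->] := ltgtP a 0.
    * by rewrite -[in LHS](opprK a) scaleNr psi_even psipZ ?oppr_gt0// ltr0_norm.
    * by rewrite psipZ// gtr0_norm.
    * by rewrite scale0r normr0 mul0r sublinear0.
  + by case: sub.
- by exists k, N; split => // x.
- move=> c Cc; apply: cone_inf_le => //; exists c, 0; split => //.
  by rewrite dual0 subrr !addr0 normr0 mulr0 addr0.
- exists k => // x e xe; apply: cone_inf_ge => // s [c1 [c2 [Cc1 Cc2]]].
  apply: le_trans; set y := x - c1 + c2.
  have fx : f x = f y + f c1 - f c2.
    by rewrite /y !dualD dualN; ring.
  have : k * e <= k * (`|y| + `|c2|).
    rewrite ler_pM2l// (le_trans (xe _ Cc1))// (le_trans _ (ler_normB _ _))//.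
    by rewrite addrK.
  have := fN y; have := fk _ Cc2; have := kn y.
  have : 0 <= f c2 by apply: le_trans (fk _ Cc2); rewrite mulr_ge0// ltW.
  lra.
Qed.

Definition weak_cvg {T : Type} (F : set_system T) (a : T -> Y) (p : Y) :=
  forall g, g (a n) @[n --> F] --> (g p : R).

(** The last hypothesis speaks of limits along ultrafilters so that norm compactness, weak
    compactness and reflexivity can all supply it. *)
Lemma cone_gap A C f (d : R) : is_cone A -> is_cone C -> @convex_set R Y C ->
  0 < d -> (forall c, C c -> d * `|c| <= f c) ->
  A `&` closure C = [set 0] ->
  (forall (a : nat -> Y), (forall n, norm_base A (@Num.norm R Y) (a n)) ->
   forall U : set_system nat, UltraFilter U -> exists2 p, A p & weak_cvg U a p) ->
  exists2 e : R, 0 < e & forall x c, A x -> C c -> e * `|x| <= `|x - c|.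
Proof.
move=> coneA coneC cvxC d0 fC AC Acpt; apply: contrapT => nogap.
have /choice[ac acP] (n : nat) : exists ac : Y * Y,
    [/\ norm_base A (@Num.norm R Y) ac.1, C ac.2 & `|ac.1 - ac.2| < n.+1%:R^-1].
  apply: contrapT => h; apply: nogap; exists n.+1%:R^-1; first by rewrite invr_gt0.
  move=> x c Ax Cc; have [->|x0] := eqVneq x 0; first by rewrite normr0 mulr0.
  have xp : 0 < `|x| by rewrite normr_gt0.
  rewrite leNgt; apply/negP => xc; apply: h.
  exists (`|x|^-1 *: x, `|x|^-1 *: c) => /=; split.
  - split; first by apply: coneZ => //; rewrite invr_ge0.
    by rewrite normrZ normfV normr_id mulVf// gt_eqF.
  - by apply: coneZ => //; rewrite invr_ge0.
  - by rewrite -scalerBr normrZ normfV normr_id ltr_pdivrMl// mulrC.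
have [U [UU Uoo]] := @ultraFilterLemma _ (\oo : set_system nat) _.
have [p Ap ap] := Acpt (fst \o ac) (fun n => let: And3 h _ _ := acP n in h) U UU.
(* The second components have the same weak limit, as the differences tend to 0 in norm. *)
have cp g : g (ac n).2 @[n --> U] --> (g p : R).
  have -> : (fun n => g (ac n).2 : R) =
            (fun n => g (ac n).1 - g ((ac n).1 - (ac n).2)).
    by apply/funext => n; rewrite dualD dualN opprD opprK addNKr.
  rewrite -[g p : R]subr0; apply: cvgB; first exact: ap.
  apply/cvgrPdist_lt => e e0; rewrite near_simpl.
  pose e' := e / (opnorm g + 1).
  have g1 : 0 < opnorm g + 1 by rewrite ltr_wpDl ?opnorm_ge0.
  have e'0 : 0 < e' by rewrite divr_gt0.
  have /Uoo := near_infty_natSinv_lt (PosNum e'0); apply: filterS => n /= ne.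
  rewrite sub0r normrN (le_lt_trans (opnormP _ _))//.
  have [_ _ /lt_trans/(_ ne)] := acP n; rewrite ltr_pdivlMr//.
  by apply: le_lt_trans; rewrite mulrC ler_wpM2l// lerDl.
(* A norm-closed convex set is weakly closed: a functional separating [C - p] from 0 would keep
   [g c] at least [r] above [g p] on [C]. *)
have Cp : closure C p.
  apply: contrapT => /notin_closure[r r0 Cr].
  have [||g gC] := @convex_separation _ _ [set c - p | c in C] r.
  - apply/convex_setP => _ _ t [x Cx <-] [y Cy <-] t0 t1.
    exists (t *: x + (1 - t) *: y); first by move/convex_setP: cvxC; apply.
    rewrite !scalerBr addrACA -opprD -scalerDl addrCA subrr addr0.
    by rewrite scale1r.
  - by move=> _ [c Cc <-]; rewrite -normrN opprB; exact: Cr.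
  have : r + g p <= g p; last lra.
  apply: (cvgr_to_ge (cp g)); apply: nearW => n /=.
  have [_ Cc _] := acP n.
  by have := gC _ (imageP _ Cc); rewrite dualD dualN; lra.
have p0 : p = 0 by have : (A `&` closure C) p by []; rewrite AC.
(* Since [|a_n| = 1], having [|a_n - c_n| < 1/2] forces [|c_n| >= 1/2]. *)
have : d / 2 <= f p; last by rewrite p0 dual0; lra.
apply: (cvgr_to_ge (cp f)).
have h2 : 0 < 2^-1 :> R by lra.
have /Uoo := near_infty_natSinv_lt (PosNum h2); apply: filterS => n /= n2.
have [[_ an1] Cc /lt_trans/(_ n2) lt2] := acP n.
apply: le_trans (fC _ Cc); rewrite ler_pM2l//.
have := lerB_dist (ac n).1 (ac n).2; rewrite an1; lra.
Qed.

End Renorming.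

(** * Weak limits along ultrafilters *)

Lemma fmap_ultra {T V : Type} (a : T -> V) (F : set_system T) :
  UltraFilter F -> UltraFilter (a @ F).
Proof.
move=> FU; split; first exact: fmap_proper_filter.
move=> G GP FG; apply/seteqP; split=> [B GB|]; last exact: FG.
have [//|FB] := in_ultra_setVsetC (a @^-1` B) FU.
have /(filterI GB) : G (~` B) by exact: FG.
by rewrite setICr => /filter_not_empty.
Qed.

Section WeakLimits.
Context {R : realType} {Y : normedModType R}.
Implicit Types (A E : set Y) (f g : dual Y).

Lemma weak_cvgP {T : Type} (F : set_system T) (a : T -> Y) (p : Y) :
  ProperFilter F -> (a : T -> weak_space Y) @ F --> (p : weak_space Y) <->
  weak_cvg F a p.
Proof.
move=> FF; split=> [/cvg_sup ap g|ap].
  apply: (continuous_cvg _ (@initial_continuous _ _ (dual_fun g) p)) => //.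
  exact: ap.
apply/cvg_sup => g B pB.
have : nbhs (p : initial_topology (dual_fun g)) B by exact: pB.
rewrite nbhsE => -[_ [[V oV <-] Vp] VB].
have /ap : nbhs (g p : R) V by exact: open_nbhs_nbhs.
move=> FV; apply: (@filterS _ F _ ((g \o a) @^-1` V)) => // t; exact: VB.
Qed.

Lemma norm_weak_cvg {T : Type} (F : set_system T) (a : T -> Y) (p : Y) :
  ProperFilter F -> a @ F --> p -> weak_cvg F a p.
Proof.
by move=> FF ap g; apply: (continuous_cvg _ (@dual_continuous _ _ g p)).
Qed.

(* The pointwise limits of [a] along [U] define an element of the bidual. *)
Lemma reflexive_weak_limit (a : nat -> Y) (M : R) (U : set_system nat) :
  reflexive_space Y -> (forall n, `|a n| <= M) -> UltraFilter U ->
  exists p, weak_cvg U a p.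
Proof.
move=> rY aM UU.
(* The values [g (a n)] stay in a compact segment, so they converge along [U]; the bound on the
   limit makes [Phi] continuous. *)
have /choice[Phi PhiP] g : exists v : R,
    [/\ g (a n) @[n --> U] --> v & `|v| <= M * opnorm g].
  have := @segment_compact R (- (M * opnorm g)) (M * opnorm g).
  rewrite compact_ultra => /(_ _ (@fmap_ultra _ _ (fun n => g (a n) : R) U UU)).
  case=> [|v [vM gv]].
    apply: nearW => n /=; rewrite in_itv/= -ler_norml (le_trans (opnormP _ _))//.
    by rewrite mulrC ler_wpM2r// opnorm_ge0.
  by exists v; split => //; move: vM; rewrite /= in_itv/= -ler_norml.
have lPhi : linear (Phi : dual Y -> R^o).
  move=> b g h; have [gh _] := PhiP (b *: g + h).
  have [gP _] := PhiP g; have [hP _] := PhiP h.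
  apply: (@cvg_unique _ (@Rhausdorff R) _ _ _ _ gh).
  exact: (cvgD (cvgM (cvg_cst b) gP) hP).
have [Psi PsiE] : exists Psi : dual (dual Y), dual_fun Psi = Phi.
  apply: (@dual_of_bounded _ _ _ M) => // g.
  by have [_] := PhiP g.
have [p pP] := rY Psi; exists p => g.
by rewrite -pP PsiE; have [] := PhiP g.
Qed.

End WeakLimits.

(** * Half-spaces and the separation of the two closed hulls *)

Section Halfspace.
Context {R : realType} {Y : normedModType R}.

(** A half-space given by a continuous functional is convex and closed. *)
Lemma closure_conv_hull_halfspace (E : set Y) (f : dual Y) (m : R) :
  (forall x, E x -> f x <= m) -> forall x, closure (conv_hull E) x -> f x <= m.
Proof.
move=> Em; have : closure (conv_hull E) `<=` closure [set x | f x <= m].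
  apply: closure_subset; apply: conv_hull_min => //.
  apply/convex_setP => x y t /= fx fy t0 t1; rewrite dualD !dualZ.
  have : t * f x <= t * m by rewrite ler_wpM2l.
  have : (1 - t) * f y <= (1 - t) * m by rewrite ler_wpM2l// subr_ge0.
  lra.
move=> h x /h; suff : closed [set x | f x <= m] by apply.
apply: (@closed_comp _ _ (f : Y -> R) [set t | t <= m]); last exact: closed_le.
by move=> y _; exact: dual_continuous.
Qed.

End Halfspace.

Theorem proposition23 (R : realType) (Y : normedModType R) (K A : set Y)
  (dimY : dim_ge2 Y)
  (coneK : is_cone K) (ntK : nontrivial K)
  (coneA : is_cone A) (ntA : nontrivial A)
  (hAK : A `&` closure (conv_hull (opp_set K)) = [set 0])
  (hK : ~ closure (conv_base (opp_set K) (@Num.norm R Y)) 0)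
  (hab : compact (norm_base A (@Num.norm R Y)) \/
         (weakly_closed A /\
          (reflexive_space Y \/
           (weakly_compact (weak_closure (norm_base A (@Num.norm R Y))) /\
            ~ weak_closure (norm_base A (@Num.norm R Y)) 0)))) :
  exists psi : Y -> R,
    [/\ is_norm psi,
        equivalent_norms (@Num.norm R Y) psi
      & closure (conv_base0 A psi) `&` closure (conv_base (opp_set K) psi)
        = set0].
Proof.
have coneN : is_cone (opp_set K) by exact: opp_cone.
have coneC : is_cone (conv_hull (opp_set K)).
  split; first by apply: sub_conv_hull; case: coneN.
  rewrite eqEsubset; split=> [x Cx|_ [t t0 [x Cx <-]]].
    by exists 1 => //=; exists x => //; rewrite scale1r.
  exact: conv_hull_coneZ.
have [d d0 Kd] := @notin_closure _ _ _ _ hK.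
have [x Kx|f fd] := convex_separation _ d
    (convex_conv_hull (norm_base (opp_set K) (@Num.norm R Y))).
  by have := Kd _ Kx; rewrite sub0r normrN.
(* The inequality passes from the norm-base to the cone by scaling, and to the hull because its
   solutions form a convex set. *)
have fC c : conv_hull (opp_set K) c -> d * `|c| <= f c.
  move: c; apply: (@conv_hull_min _ _ _ [set c | d * `|c| <= f c]).
    apply/convex_setP => x y t /= dx dy t0 t1; rewrite dualD !dualZ.
    have t1' : 0 <= 1 - t by rewrite subr_ge0.
    have := ler_normD (t *: x) ((1 - t) *: y).
    rewrite !normrZ !ger0_norm// -(ler_pM2l d0) => /le_trans; apply.
    by rewrite mulrDr lerD// mulrCA ler_wpM2l.
  move=> x Kx /=; have [->|x0] := eqVneq x 0.
    by rewrite normr0 mulr0 dual0.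
  have xp : 0 < `|x| by rewrite normr_gt0.
  rewrite -ler_pdivlMr// mulrC -dualZ; apply: fd; apply: sub_conv_hull.
  split; first by apply: coneZ => //; rewrite invr_ge0.
  by rewrite normrZ normfV normr_id mulVf// gt_eqF.
have [||e e0 eAC] := @cone_gap _ _ A _ f d coneA coneC (convex_conv_hull _) d0 fC.
- exact: hAK.
- move=> a aA U UU; have aU B : (forall n, B (a n)) -> (a @ U) B.
    by move=> aB; apply: nearW.
  have baseA : norm_base A (@Num.norm R Y) `<=` A by move=> x [].
  case: hab => [|[clA]].
    rewrite compact_ultra => /(_ _ (@fmap_ultra _ _ a U UU) (aU _ aA))[p [Bp ap]].
    by exists p; [exact: baseA|exact: norm_weak_cvg].
  case=> [rY|[+ _]].
    have [|p ap] := @reflexive_weak_limit _ _ a 1 U rY _ UU.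
      by move=> n; have [_ ->] := aA n.
    exists p => //; apply: (@closed_cvg _ (weak_space Y) U _ a A) => //.
      by apply: nearW => n; exact/baseA/aA.
    exact/weak_cvgP.
  rewrite /weakly_compact compact_ultra => /(_ _ (@fmap_ultra _ _ a U UU)).
  case=> [|p [Bp ap]]; first by apply: aU => n; exact/subset_closure/aA.
  exists p; last exact/weak_cvgP.
  by apply: clA; exact: (@closure_subset (weak_space Y) _ _ baseA).
have [|psi [npsi epsi psiC [k k0 kpsi]]] := @renorming _ _ _ f d coneC _ d0 fC.
  by move=> x y; exact: conv_hull_coneD.
exists psi; split => //; apply/seteqP; split=> // p [pA pK].
have [c1 [c2 [_ c20 psi12]]] := epsi.
(* If [psi x = 1] then [|x| >= 1 / c2], so a point [x] of [A] has distance at least [e / c2] from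
   the hull and [f x <= 1 - k * (e / c2)]. The maximum with 0 accounts for the origin in
   [conv_base0]. *)
pose m := Num.max 0 (1 - k * (e / c2)).
have m1 : m < 1 by rewrite gt_max ltr01/= gtrBl mulr_gt0// divr_gt0.
have fm : f p <= m.
  apply: closure_conv_hull_halfspace pA => x [->|[Ax px]].
    by rewrite dual0 le_max lexx.
  rewrite le_max; apply/orP; right; rewrite lerBrDr -px.
  apply: le_trans (kpsi x (e * `|x|) _); last by move=> c; exact: eAC.
  rewrite lerD2l ler_pM2l// ler_pM2l// -div1r ler_pdivrMr// mulrC -px.
  by case: (psi12 x).
(* Passing to [- f] turns the half-space where [f] is at least 1 into one bounded above. *)
suff : (- f) p <= -1.
  by rewrite [(- f) p]/(- f p) lerN2 leNgt (le_lt_trans fm m1).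
apply: closure_conv_hull_halfspace pK => x [Kx px].
rewrite [(- f) x]/(- f x) lerN2 -px; apply: psiC; exact: sub_conv_hull.
Qed.
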